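(* Let $X$ be a topological space together with the specialisation preorder $\leq$, and assume that $(X,\leq)$ is not a poset. Consider the poset $X/\sim$ under $\leq$ and the poset $X$ under $\preceq$. Let $G^n_1$ (with homomorphisms $\partial^n_1$) be the groups in the simplicial cochain complex of $\Delta(X/\sim)|_{\leq}$, and let $G^n_2$ (with homomorphisms $\partial^n_2$) be the groups in the relative simplicial cochain complex of $\Delta(X)$ (under $\preceq$) and its subcomplex $\Delta(X/\sim)|_{\preceq}$. Then we can define the cochain complex $$0 \rightarrow G^0_1 \xrightarrow{\partial^0_1} G^1_1 \xrightarrow{\partial^1_1} G^2_1 \xrightarrow{0} G^0_2 \xrightarrow{\partial^0_2} G^1_2 \xrightarrow{\partial^1_2} G^2_2 \xrightarrow{0} G^3_1 \xrightarrow{\partial^3_1} G^4_1 \xrightarrow{\partial^4_1} \cdots$$ (three consecutive groups of the first complex alternate with three consecutive groups of the second, and consecutive blocks are joined by the trivial homomorphism $0$). The cohomology groups obtained from this complex, denoted by $\widehat{H}^k(X)$, are, for $p \in \mathbb{N}_0$: $$\widehat{H}^{6p}(X) = H^{3p}(X/\sim),$$ $$\widehat{H}^{6p+1}(X) = G^{3p+2}_1 / \operatorname{Im} \partial^{3p+1}_1,$$ $$\widehat{H}^{6p+2}(X) \cong \ker \partial^{3p}_2,$$ $$\widehat{H}^{6p+3}(X) = H^{3p}(X \setminus (X/\sim)),$$ $$\widehat{H}^{6p+4}(X) = G^{3p+2}_2 / \operatorname{Im} \partial^{3p+1}_2,$$ $$\widehat{H}^{6p+5}(X) \cong \ker \partial^{3p+3}_1,$$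 where $H^{n}(X/\sim)$ denotes the simplicial cohomology of $\Delta(X/\sim)|_{\leq}$ and $H^{n}(X \setminus (X/\sim))$ denotes the relative simplicial cohomology of $\Delta(X)$ and $\Delta(X/\sim)|_{\preceq}$.
   Context: The specialisation preorder on $X$ is $x \leq y \Leftrightarrow x \in \overline{\{y\}}$ (closure in $X$). The equivalence relation $\sim$ on $X$ is $x \sim y \Leftrightarrow (x \leq y \text{ and } y \leq x)$; $X/\sim$ is a poset under $\leq$, and is regarded as a subset of $X$ by choosing one representative in each class. The partial order $\preceq$ on $X$ is defined by $x \prec y \Leftrightarrow (x \leq y \text{ and not } y \leq x)$, and $x \preceq y \Leftrightarrow (x \prec y \text{ or } x=y)$; the subset $X/\sim$ is also a poset under the induced relation $\preceq$. The order complex $\Delta(P)$ of a poset $P$ is the simplicial complex whose vertices are the points of $P$ and whose faces are the totally ordered subsets (chains) of $P$. $\Delta(X)$ is the order complex of $(X,\preceq)$; $\Delta(X/\sim)|_{\leq}$ and $\Delta(X/\sim)|_{\preceq}$ are the order complexes of $X/\sim$ under $\leq$ and $\preceq$ respectively, and $\Delta(X/\sim)|_{\preceq}$ is a subcomplex of $\Delta(X)$. The cochain complexes are obtained from the corresponding simplicial (respectively relative simplicial) chain complexes by applying $\operatorname{Hom}(\cdot, G)$ for some abelian group $G$, and $\partial^n_i : G^n_i \to G^{n+1}_i$ are the usual coboundary homomorphisms. The notation $X \setminus (X/\sim)$ in $H^n(X \setminus (X/\sim))$ is only a label for the relative cohomology.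
   Formalization: Every cohomology group (of the spliced complex, of X/∼ and the relative one) is indexed as Hⁿ = ker ∂ⁿ⁺¹/Im ∂ⁿ, with Gⁿ the n-cochains; with the usual ker ∂ⁿ/Im ∂ⁿ⁻¹ the displayed list fails, e.g. for the two-point indiscrete space and G ≠ 0. *)

(* Defs.v *)
From HB Require Import structures.
From mathcomp Require Import all_boot all_order all_algebra.
From mathcomp Require Import generic_quotient ring_quotient finmap.
From mathcomp Require Import freeg.
From mathcomp Require Import mathcomp_extra boolp classical_sets topology.

Set Implicit Arguments.
Unset Strict Implicit.
Unset Printing Implicit Defensive.

Import GRing.Theory.

Local Open Scope quotient_scope.
Local Open Scope ring_scope.

Section KerIm.
Variables (A B : zmodType) (f : {additive A -> B}).

Definition ker : {pred A} := [pred x | f x == 0].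
Definition im : {pred B} := [pred y | `[< exists x, f x = y >]].

Lemma ker_zmod_closed : zmod_closed ker.
Proof.
split=> [|x y]; rewrite !inE; first by rewrite raddf0.
move=> /eqP fx /eqP fy.
by rewrite raddfB fx fy subrr.
Qed.

Lemma im_zmod_closed : zmod_closed im.
Proof.
split=> [|x y]; first by apply/asboolP; exists 0; rewrite raddf0.
move=> /asboolP[a <-] /asboolP[b <-]; apply/asboolP.
by exists (a - b); rewrite raddfB.
Qed.

HB.instance Definition _ := GRing.isZmodClosed.Build A ker ker_zmod_closed.
HB.instance Definition _ := GRing.isZmodClosed.Build B im im_zmod_closed.
End KerIm.

Lemma full_zmod_closed (A : zmodType) : zmod_closed (xpredT : {pred A}).
Proof. by split. Qed.

Definition full (A : zmodType) : {pred A} := xpredT.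
HB.instance Definition _ (A : zmodType) :=
  GRing.isZmodClosed.Build A (@full A) (@full_zmod_closed A).

Record subgroup (A : zmodType) (Z : zmodClosed A) :=
  Subgroup { subgroup_val : A; _ : subgroup_val \in Z }.

HB.instance Definition _ A Z := [isSub for @subgroup_val A Z].
HB.instance Definition _ (A : zmodType) (Z : zmodClosed A) :=
  [Choice of subgroup Z by <:].
HB.instance Definition _ (A : zmodType) (Z : zmodClosed A) :=
  [SubChoice_isSubZmodule of subgroup Z by <:].

Section Subquotient.
Variables (A : zmodType) (Z B : zmodClosed A).

Definition restrict : {pred subgroup Z} := [pred z | val z \in B].

Lemma restrict_zmod_closed : zmod_closed restrict.
Proof.
split=> [|x y]; rewrite !inE ?raddf0 ?rpred0 // => xB yB.
by rewrite raddfB rpredB.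
Qed.

HB.instance Definition _ :=
  GRing.isZmodClosed.Build (subgroup Z) restrict restrict_zmod_closed.

(* The quotient group Z / B, when B is contained in Z. *)
Definition subquotient : zmodType := Quotient.quot restrict.
End Subquotient.

Definition isomorphic (A B : zmodType) : Prop :=
  exists f : {additive A -> B}, bijective f.

Section Hom.
Variables A G : zmodType.

Definition Hom := {additive A -> G}.

HB.instance Definition _ := gen_eqMixin Hom.
HB.instance Definition _ := gen_choiceMixin Hom.

Lemma hom_ext (f g : {additive A -> G}) : f =1 g -> f = g.
Proof.
case: f g => [f [[hf]]] [g [[hg]]] /= /funext fg; subst g.
by rewrite (Prop_irrelevance hf hg).
Qed.

Definition hom_zero : Hom := (\0 : {additive A -> G}).
Definition hom_opp (f : Hom) : Hom := (\- f : {additive A -> G}).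
Definition hom_add (f g : Hom) : Hom := (f \+ g : {additive A -> G}).

Fact hom_addA : associative hom_add.
Proof. by move=> f g h; apply: hom_ext => x /=; rewrite addrA. Qed.
Fact hom_addC : commutative hom_add.
Proof. by move=> f g; apply: hom_ext => x /=; rewrite addrC. Qed.
Fact hom_add0 : left_id hom_zero hom_add.
Proof. by move=> f; apply: hom_ext => x /=; rewrite add0r. Qed.
Fact hom_addN : left_inverse hom_zero hom_opp hom_add.
Proof. by move=> f; apply: hom_ext => x /=; rewrite addNr. Qed.

HB.instance Definition _ :=
  GRing.isZmodule.Build Hom hom_addA hom_addC hom_add0 hom_addN.
End Hom.

Section Precompose.
Variables (A B G : zmodType) (d : {additive A -> B}).

Definition precompose (f : Hom B G) : Hom A G := (f : {additive B -> G}) \o d.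

Lemma precompose_zmod_morphism : zmod_morphism precompose.
Proof. by move=> f g; apply: hom_ext. Qed.

HB.instance Definition _ :=
  GRing.isZmodMorphism.Build (Hom B G) (Hom A G) precompose
    precompose_zmod_morphism.
End Precompose.

Record chain_sequence := ChainSequence {
  chain :> nat -> zmodType;
  bdry : forall n, {additive chain n.+1 -> chain n} }.

Record cochain_sequence := CochainSequence {
  cochain :> nat -> zmodType;
  cobdry : forall n, {additive cochain n -> cochain n.+1} }.

Definition is_cochain_complex (C : cochain_sequence) : Prop :=
  forall n (x : C n), cobdry C n.+1 (cobdry C n x) = 0.

Definition hom_sequence (C : chain_sequence) (G : zmodType) : cochain_sequence :=
  {| cochain n := Hom (C n) G; cobdry n := @precompose _ _ G (bdry C n) |}.

(* H^n is indexed by the source of the incoming coboundary: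
     H^n(C) = ker (d^(n+1) : C^(n+1) -> C^(n+2)) / Im (d^n : C^n -> C^(n+1)),
   one less than the common indexing ker d^n / Im d^(n-1). It is the only
   uniform indexing for which, along C^0 -> C^1 -> C^2 -0-> D^0 -> ..., the
   cohomology groups start with H^0(C), C^2 / Im d^1, ker (d^0 of D), H^0(D);
   with the common indexing they start with ker d^0, H^1(C), C^2 / Im d^1. *)
Definition cohomology (C : cochain_sequence) (n : nat) : zmodType :=
  subquotient (ker (cobdry C n.+1)) (im (cobdry C n)).

(* C^(n+1) / Im d^n; the whole group is taken as a subgroup of itself so that
   this has the same form as the cohomology groups. *)
Definition coker (C : cochain_sequence) (n : nat) : zmodType :=
  subquotient (@full (C n.+1)) (im (cobdry C n)).

Definition shift3 (C : cochain_sequence) : cochain_sequence :=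
  {| cochain n := C n.+3; cobdry n := cobdry C n.+3 |}.

(* C^0 -> C^1 -> C^2 -0-> D^0 -> D^1 -> D^2 -0-> C^3 -> C^4 -> C^5 -0-> D^3 -> ... :
   three groups of C, followed by the splicing of D with the rest of C. *)
Fixpoint splice_group (C D : cochain_sequence) (k : nat) {struct k} : zmodType :=
  match k with
  | 0 => C 0
  | 1 => C 1
  | 2 => C 2
  | k'.+3 => splice_group D (shift3 C) k'
  end.

Fixpoint splice_cobdry (C D : cochain_sequence) (k : nat) {struct k} :
    {additive splice_group C D k -> splice_group C D k.+1} :=
  match k with
  | 0 => cobdry C 0
  | 1 => cobdry C 1
  | 2 => (\0 : {additive C 2 -> D 0})
  | k'.+3 => splice_cobdry D (shift3 C) k'
  end.

Definition splice (C D : cochain_sequence) : cochain_sequence :=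
  {| cochain := splice_group C D; cobdry := splice_cobdry C D |}.

Record simplicial_complex (V : choiceType) := SimplicialComplex {
  face :> set {fset V};
  face_neq0 : forall A, face A -> A != fset0;
  face_sub : forall A B, (B `<=` A)%fset -> B != fset0 -> face A -> face B }.

Definition is_subcomplex (V : choiceType) (L K : simplicial_complex V) : Prop :=
  (face L `<=` face K)%classic.

Record simplex (V : choiceType) (K : simplicial_complex V) (n : nat) := Simplex {
  vertices : {fset V};
  _ : `[< face K vertices >] && (#|` vertices| == n.+1) }.

HB.instance Definition _ V K n := [isSub for @vertices V K n].
HB.instance Definition _ (V : choiceType) (K : simplicial_complex V) n :=
  [Choice of simplex K n by <:].

Section FreeLift.
Variables (K : choiceType) (M : lmodType int) (f : K -> M).

Definition free_lift : {freeg K / int} -> M := fglift f.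

HB.instance Definition _ :=
  GRing.isZmodMorphism.Build {freeg K / int} M free_lift (lift_is_additive f).

Lemma free_liftU x : free_lift << x >> = f x.
Proof. by rewrite /free_lift liftU scale1r. Qed.
End FreeLift.

Lemma freegU_intmul (K : choiceType) (c : int) (x : K) :
  << c *g x >> = << x >> *~ c :> {freeg K / int}.
Proof. by rewrite freegU_mulz intz. Qed.

Lemma free_hom_ext (K : choiceType) (M : zmodType)
    (f g : {additive {freeg K / int} -> M}) :
  (forall x, f << x >> = g << x >>) -> f =1 g.
Proof.
move=> fg D; rewrite -[D]freeg_sumE !raddf_sum; apply: eq_bigr => x _.
by rewrite freegU_intmul !raddfMz fg.
Qed.

Section Boundary.
Variables (V : choiceType) (R : V -> V -> Prop) (K : simplicial_complex V).

Section Facet.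
Variables (n : nat) (s : simplex K n.+1) (x : vertices s).

Lemma facet_subproof :
  let A := (vertices s `\ fsval x)%fset in
  `[< face K A >] && (#|` A| == n.+1).
Proof.
have /andP[/asboolP Ks /eqP cs] := valP s.
have cA : #|` (vertices s `\ fsval x)%fset| = n.+1.
  by have := cardfsD1 (fsval x) (vertices s); rewrite fsvalP cs => -[].
rewrite /= cA eqxx andbT; apply/asboolP; apply: face_sub Ks.
- exact: fsubD1set.
- by rewrite -cardfs_eq0 cA.
Qed.

Definition facet : simplex K n := Simplex facet_subproof.

(* If R totally orders the vertices of s as v_0 < ... < v_n.+1, then
   position v_i = i. *)
Definition position : nat :=
  #|` [fset y in vertices s | `[< R y (fsval x) /\ y <> fsval x >]]%fset|.
End Facet.

(* The boundary of <v_0, ..., v_n.+1> is the sum of the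
   (-1)^i <v_0, ..., v_i omitted, ..., v_n.+1>, where the vertices are listed in
   the order given by R; a simplex and its oriented listing are thus identified. *)
Definition simplex_boundary n (s : simplex K n.+1) : {freeg (simplex K n) / int} :=
  \sum_(x : vertices s) << (-1) ^+ position x *g facet x >>.

Definition boundary n :
    {additive {freeg (simplex K n.+1) / int} -> {freeg (simplex K n) / int}} :=
  free_lift (@simplex_boundary n).

Definition simplicial_chains : chain_sequence :=
  {| chain n := {freeg (simplex K n) / int}; bdry := boundary |}.
End Boundary.

Section RelativeChains.
Variables (V : choiceType) (R : V -> V -> Prop).
Variables (K L : simplicial_complex V) (LK : is_subcomplex L K).

Lemma simplex_incl_subproof n (s : simplex L n) :
  `[< face K (vertices s) >] && (#|` vertices s| == n.+1).
Proof.
have /andP[/asboolP Ls ->] := valP s.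
by rewrite andbT; apply/asboolP; exact: LK.
Qed.

Definition simplex_incl n (s : simplex L n) : simplex K n :=
  Simplex (simplex_incl_subproof s).

Definition chain_incl n :
    {additive {freeg (simplex L n) / int} -> {freeg (simplex K n) / int}} :=
  free_lift (fun s => << simplex_incl s >>).

Lemma boundary_incl n c :
  boundary R K n (chain_incl n.+1 c) = chain_incl n (boundary R L n c).
Proof.
apply: (free_hom_ext (f := boundary R K n \o chain_incl n.+1)
                     (g := chain_incl n \o boundary R L n)) => s /=.
rewrite !free_liftU /simplex_boundary raddf_sum; apply: eq_bigr => x _.
rewrite [in RHS]freegU_intmul [RHS]raddfMz /= free_liftU -freegU_intmul.
congr << _ *g _ >>; exact: val_inj.
Qed.

Local Notation quot n := (Quotient.quot (im (chain_incl n))).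

Definition relative_chain n : zmodType := quot n.

Definition relative_boundary n (c : quot n.+1) : quot n :=
  \pi_(quot n) (boundary R K n (repr c)).

Lemma relative_boundary_pi n (c : {freeg (simplex K n.+1) / int}) :
  relative_boundary (\pi_(quot n.+1) c) = \pi_(quot n) (boundary R K n c).
Proof.
apply/eqP; rewrite -Quotient.idealrBE -raddfB /=.
have : repr (\pi_(quot n.+1) c) - c \in im (chain_incl n.+1).
  by rewrite Quotient.idealrBE reprK.
move=> /asboolP[a <-]; apply/asboolP.
by exists (boundary R L n a); rewrite boundary_incl.
Qed.

Lemma relative_boundary_zmod_morphism n : zmod_morphism (@relative_boundary n).
Proof.
move=> x y; rewrite -[x]reprK -[y]reprK -raddfB !relative_boundary_pi.
by rewrite !raddfB.
Qed.

HB.instance Definition _ n :=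
  GRing.isZmodMorphism.Build (relative_chain n.+1) (relative_chain n)
    (@relative_boundary n) (@relative_boundary_zmod_morphism n).

Definition relative_chains : chain_sequence :=
  {| chain := relative_chain; bdry n := @relative_boundary n |}.
End RelativeChains.

Section OrderComplex.
Variables (V : choiceType) (R : V -> V -> Prop) (P : set V).

Definition is_chain (A : {fset V}) : Prop :=
  A != fset0 /\ (forall x, x \in A -> P x) /\
  (forall x y, x \in A -> y \in A -> R x y \/ R y x).

Lemma is_chain_neq0 A : is_chain A -> A != fset0.
Proof. by case. Qed.

Lemma is_chain_sub A B :
  (B `<=` A)%fset -> B != fset0 -> is_chain A -> is_chain B.
Proof.
move=> /fsubsetP BA B0 [_ [AP AR]]; split=> //; split=> [x /BA /AP //|x y xB yB].
by apply: AR; exact: BA.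
Qed.

Definition order_complex : simplicial_complex V :=
  SimplicialComplex is_chain_neq0 is_chain_sub.
End OrderComplex.

Lemma order_complex_subset (V : choiceType) (R : V -> V -> Prop) (P Q : set V) :
  (P `<=` Q)%classic -> is_subcomplex (order_complex R P) (order_complex R Q).
Proof. by move=> PQ A [A0 [AP AR]]; split=> //; split=> // x /AP /PQ. Qed.

Section Specialisation.
Variable X : topologicalType.
Implicit Types x y : X.

Definition spec_le x y : Prop := closure [set y]%classic x.
Definition spec_eqv x y : Prop := spec_le x y /\ spec_le y x.
Definition spec_lt x y : Prop := spec_le x y /\ ~ spec_le y x.
Definition spec_preceq x y : Prop := spec_lt x y \/ x = y.

Definition spec_antisymmetric : Prop :=
  forall x y, spec_le x y -> spec_le y x -> x = y.

(* S is a choice of one representative in each class of X / ~. *)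
Definition is_representatives (S : set X) : Prop :=
  forall x, exists! s, S s /\ spec_eqv x s.
End Specialisation.

Section SpecialisationComplexes.
Variables (X : topologicalType) (S : set X) (G : zmodType).

Definition quotient_cochains : cochain_sequence :=
  hom_sequence
    (simplicial_chains (@spec_le X) (order_complex (@spec_le X) S)) G.

Definition relative_cochains : cochain_sequence :=
  hom_sequence
    (relative_chains (@spec_preceq X)
       (order_complex_subset (R := @spec_preceq X) (@subsetT X S))) G.
End SpecialisationComplexes.

(* Main.v *)
(* The blocks of the spliced sequence have period 6 in the degree, and shifting
   by three swaps the roles of the two complexes, so every identification reduces
   to degrees 0, 1 and 2 of an arbitrary splice; there the joining map 0 has full
   kernel and trivial image. That the two sequences of cochains are complexes
   comes down to the cancellation in pairs of the terms omitting x, y and y, x: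
   if x precedes y, then omitting x lowers the position of y by one, while
   omitting y does not change the position of x. *)
Require Import Defs.
From HB Require Import structures.
From mathcomp Require Import all_boot all_order all_algebra.
From mathcomp Require Import generic_quotient ring_quotient finmap freeg.
From mathcomp Require Import boolp classical_sets topology.

Set Implicit Arguments.
Unset Strict Implicit.
Unset Printing Implicit Defensive.

Import GRing.Theory.

Local Open Scope quotient_scope.
Local Open Scope ring_scope.

Section BoundarySquared.
Variables (V : choiceType) (R : V -> V -> Prop) (K : simplicial_complex V).

(** The default 0 makes generators depend on bare sets, so the two orders of deleting a pair give
    the same term. *)
Definition face_chain n (B : {fset V}) : {freeg (simplex K n) / int} :=
  if insub B is Some s then << s >> else 0.

Lemma face_chainE n (s : simplex K n) : << s >> = face_chain n (vertices s).
Proof. by rewrite /face_chain valK. Qed.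

Definition vertex_position (A : {fset V}) (x : V) : nat :=
  #|` [fset y in A | `[< R y x /\ y <> x >]]%fset|.

Lemma simplex_boundaryE n (s : simplex K n.+1) :
  simplex_boundary R s =
  \sum_(x <- vertices s)
    face_chain n (vertices s `\ x)%fset *~ (-1) ^+ vertex_position (vertices s) x.
Proof.
rewrite big_seq_fsetE /=; apply: eq_bigr => x _.
by rewrite freegU_intmul face_chainE.
Qed.

Lemma vertex_position_rem (A : {fset V}) x y : x \in A ->
  vertex_position A y =
  (`[< R x y /\ x <> y >] + vertex_position (A `\ x)%fset y)%N.
Proof.
move=> xA; rewrite /vertex_position (cardfsD1 x) !inE xA /=.
congr (_ + _)%N; congr #|` _|.
by apply/fsetP => z; rewrite !inE andbA.
Qed.

(** Both conditions are asked only within a face: [spec_preceq] is total only on chains, and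
    [spec_le] is antisymmetric only on representatives. *)
Hypothesis R_total : forall A x y,
  face K A -> x \in A -> y \in A -> R x y \/ R y x.
Hypothesis R_anti : forall A x y,
  face K A -> x \in A -> y \in A -> R x y -> R y x -> x = y.

Lemma boundary_simplex_boundary n (s : simplex K n.+2) :
  boundary R K n (simplex_boundary R s) = 0.
Proof.
have /andP[/asboolP Ks _] := valP s; set A := vertices s in Ks *.
(* The signed term of the double boundary that omits [x] first and [y] second. *)
pose F x y := face_chain n (A `\ x `\ y)%fset *~
  ((-1) ^+ vertex_position (A `\ x)%fset y * (-1) ^+ vertex_position A x).
have -> : boundary R K n (simplex_boundary R s) =
          \sum_(x <- A) \sum_(y <- A | y != x) F x y.
  rewrite raddf_sum /= big_seq_fsetE /=; apply: eq_bigr => x _.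
  rewrite freegU_intmul raddfMz /= free_liftU simplex_boundaryE /=.
  rewrite mulrz_suml -[RHS]big_filter.
  rewrite (perm_big [seq y <- A | y != fsval x]) /=.
    by apply: eq_bigr => y _; rewrite /F mulrzA.
  apply: uniq_perm; rewrite ?filter_uniq ?fset_uniq // => y.
  by rewrite mem_filter !inE.
have Fanti x y : x \in A -> y \in A -> y != x -> R x y -> F x y + F y x = 0.
  move=> xA yA nyx Rxy.
  have nRyx : ~ R y x by move=> Ryx; rewrite (R_anti Ks xA yA Rxy Ryx) eqxx in nyx.
  rewrite /F (vertex_position_rem x yA) (vertex_position_rem y xA).
  have -> : `[< R y x /\ y <> x >] = false by apply/asboolP => -[].
  have -> : `[< R x y /\ x <> y >].
    by apply/asboolP; split=> // exy; rewrite exy eqxx in nyx.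
  have -> : (A `\ y `\ x)%fset = (A `\ x `\ y)%fset.
    by apply/fsetP => z; rewrite !inE andbCA.
  rewrite add0n add1n exprS -mulrzDr mulN1r mulrN mulrC.
  by rewrite subrr mulr0z.
(* Split the ordered pairs by whether [R x y] holds and exchange the two sums in the negative half,
   so that [F x y] meets [F y x] under the same outer index. *)
under eq_bigr => x _ do rewrite (bigID (fun y => `[< R x y >])) /=.
rewrite big_split /= [X in _ + X](exchange_big_dep xpredT) //= -big_split /=.
rewrite big_seq big1 // => x xA.
rewrite [X in _ + X](eq_bigl (fun y => (x != y) && ~~ `[< R y x >])) //.
rewrite [X in X + _]big_seq_cond [X in _ + X]big_seq_cond.
rewrite [X in _ + X](eq_bigl
  (fun y => (y \in (A : seq V)) && ((y != x) && `[< R x y >]))).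
  rewrite -big_split big1 //= => y /and3P[yA nyx /asboolP Rxy].
  exact: Fanti.
(* For distinct vertices of a face, totality and antisymmetry make the failure of [R y x] equivalent
   to [R x y]. *)
move=> y; case yA: (y \in (A : seq V)) => //=; rewrite eq_sym.
case: eqVneq => //= nyx; apply/idP/idP.
  by move=> /asboolP nRyx; apply/asboolP; case: (R_total Ks xA yA).
move=> /asboolP Rxy; apply/asboolP => Ryx.
by rewrite (R_anti Ks xA yA Rxy Ryx) eqxx in nyx.
Qed.

Lemma boundary_boundary n c : boundary R K n (boundary R K n.+1 c) = 0.
Proof.
apply: (free_hom_ext (f := boundary R K n \o boundary R K n.+1) (g := \0)) => s /=.
by rewrite free_liftU boundary_simplex_boundary.
Qed.

Lemma relative_boundary_boundary (L : simplicial_complex V)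
    (LK : is_subcomplex L K) n (c : relative_chain LK n.+2) :
  @relative_boundary V R K L LK n (@relative_boundary V R K L LK n.+1 c) = 0.
Proof. by rewrite -[c]reprK !relative_boundary_pi boundary_boundary raddf0. Qed.
End BoundarySquared.

Lemma hom_sequence_complex (C : chain_sequence) (G : zmodType) :
  (forall n c, bdry C n (bdry C n.+1 c) = 0) ->
  is_cochain_complex (hom_sequence C G).
Proof.
move=> dd n f; apply: hom_ext => c /=.
by rewrite dd raddf0.
Qed.

Lemma splice_complex C D :
  is_cochain_complex C -> is_cochain_complex D ->
  is_cochain_complex (splice C D).
Proof.
move=> + + n.
(* Strong induction with [C] and [D] general: one unfolding lowers the degree by three and passes to
   [D] and [shift3 C]. *)
have [m] := ubnP n; elim: m n C D => // m IHm [|[|[|n]]] C D nm dC dD x //=.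
- exact: dC.
- exact: raddf0.
- apply: (IHm n D (shift3 C)) => //; first by rewrite !ltnS in nm *; do 2 apply: ltnW.
  by move=> k y; apply: (dC k.+3).
Qed.

(** Every class is a singleton, so [repr] is additive and inverse to the projection. *)
Lemma subquotient_trivial (A : zmodType) (Z B : zmodClosed A) :
  (forall x, x \in B -> x = 0) -> isomorphic (subquotient Z B) (subgroup Z).
Proof.
move=> B0.
have piK : cancel (\pi_(subquotient Z B)) repr.
  move=> z; apply/eqP; rewrite -subr_eq0; apply/eqP/val_inj/B0.
  have : repr (\pi_(subquotient Z B) z) - z \in @restrict A Z B.
    by rewrite Quotient.idealrBE reprK.
  by [].
have repr_morph : zmod_morphism (repr : subquotient Z B -> subgroup Z).
  by move=> x y; rewrite -{1}[x]reprK -{1}[y]reprK -raddfB piK.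
pose m := GRing.isZmodMorphism.Build _ _ _ repr_morph.
pose f : {additive subquotient Z B -> subgroup Z} :=
  HB.pack (repr : subquotient Z B -> subgroup Z) m.
by exists f; exists (\pi_(subquotient Z B)); [exact: reprK | exact: piK].
Qed.

(** Equality of the bundled subgroups, and not just of their members, is what turns a cohomology
    group into a [coker] by rewriting. *)
Lemma zmodClosed_ext (A : zmodType) (Z W : zmodClosed A) :
  (forall x, (x \in Z) = (x \in W)) -> Z = W.
Proof.
case: Z W => [Z [[hZ] [kZ]]] [W [[hW] [kW]]] /= ZW.
have eZW : Z = W by apply/funext => x; exact: ZW.
subst W.
by rewrite (Prop_irrelevance hZ hW) (Prop_irrelevance kZ kW).
Qed.

Lemma ker_null (A B : zmodType) :
  ker (\0 : {additive A -> B}) = full (A := A) :> zmodClosed A.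
Proof. by apply: zmodClosed_ext => x; apply: eqxx. Qed.

Lemma im_null (A B : zmodType) y : y \in im (\0 : {additive A -> B}) -> y = 0.
Proof. by move=> /asboolP[x <-]. Qed.

Lemma splice_cohomology C D p :
  let E := splice C D in
  cohomology E (6 * p)%N = cohomology C (3 * p)%N /\
  cohomology E (6 * p + 1)%N = coker C (3 * p + 1)%N /\
  isomorphic (cohomology E (6 * p + 2)%N) (subgroup (ker (cobdry D (3 * p)%N))) /\
  cohomology E (6 * p + 3)%N = cohomology D (3 * p)%N /\
  cohomology E (6 * p + 4)%N = coker D (3 * p + 1)%N /\
  isomorphic (cohomology E (6 * p + 5)%N)
    (subgroup (ker (cobdry C (3 * p + 3)%N))).
Proof.
elim: p C D => [|p IHp] C D /=.
  (* Stated for arbitrary sequences, since degrees 4 and 5 are degrees 1 and 2 of the splice of [D]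
     with [shift3 C]. *)
  have coker0 C' D' : cohomology (splice C' D') 1 = coker C' 1.
    by rewrite /cohomology /= ker_null.
  have ker0 C' D' :
      isomorphic (cohomology (splice C' D') 2) (subgroup (ker (cobdry D' 0))).
    by apply: subquotient_trivial => y; apply: im_null.
  split=> //; split; first exact: coker0.
  split; first exact: ker0.
  split=> //; split; first exact: (coker0 D (shift3 C)).
  exact: (ker0 D (shift3 C)).
(* With six successors exposed, the goal is by computation the induction hypothesis for the shifted
   sequences. *)
rewrite !mulnS.
exact: (IHp (shift3 C) (shift3 D)).
Qed.

Lemma spec_preceq_anti (X : topologicalType) (x y : X) :
  spec_preceq x y -> spec_preceq y x -> x = y.
Proof. by move=> [[_ nyx]|//] [[yx _]|//]. Qed.

(** Both points represent the class of [x], whose representative is unique. *)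
Lemma spec_le_repr_anti (X : topologicalType) (S : set X) (x y : X) :
  is_representatives S -> S x -> S y -> spec_le x y -> spec_le y x -> x = y.
Proof.
move=> S_repr Sx Sy xy yx; have [z [_ uz]] := S_repr x.
have xx : spec_le x x by apply: subset_closure.
by rewrite -(uz x) // -(uz y).
Qed.

Theorem theorem2p1 (X : topologicalType) (G : zmodType) (S : set X)
    (X_not_poset : ~ spec_antisymmetric X) (S_repr : is_representatives S) :
  let C1 := quotient_cochains S G in
  let C2 := relative_cochains S G in
  let C := splice C1 C2 in
  is_cochain_complex C /\
  (forall p : nat,
     cohomology C (6 * p)%N = cohomology C1 (3 * p)%N /\
     cohomology C (6 * p + 1)%N = coker C1 (3 * p + 1)%N /\
     isomorphic (cohomology C (6 * p + 2)%N)
       (subgroup (ker (cobdry C2 (3 * p)%N))) /\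
     cohomology C (6 * p + 3)%N = cohomology C2 (3 * p)%N /\
     cohomology C (6 * p + 4)%N = coker C2 (3 * p + 1)%N /\
     isomorphic (cohomology C (6 * p + 5)%N)
       (subgroup (ker (cobdry C1 (3 * p + 3)%N)))).
Proof.
move=> C1 C2 C; split; last by move=> p; apply: splice_cohomology.
apply: splice_complex; apply: hom_sequence_complex => n c.
(* Here antisymmetry needs the vertices to lie in [S]; in the relative case it holds on all of
   [X]. *)
- apply: boundary_boundary => A x y [_ [AS Atot]] xA yA; first exact: Atot.
  by apply: spec_le_repr_anti S_repr _ _; exact: AS.
- apply: relative_boundary_boundary => A x y [_ [_ Atot]] xA yA.
    exact: Atot.
  exact: spec_preceq_anti.
Qed.
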